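(* With the notation $\mathrm{HML}^d(\mathcal{C})$ for the fragment of $\mu\mathrm{HML}^d$ using the constructs in $\mathcal{C}$ (and $\mathsf{tt}$), the following chain of strict expressiveness inclusions holds: $$\mathrm{HML}^d(\exists,\langle\,\rangle,\vee,\textsc{det})\sqsubsetneq\mathrm{HML}^d(\min,\exists,\langle\,\rangle,\vee,\textsc{det})\sqsubsetneq\mathrm{HML}^d(\min,\exists,\langle\,\rangle,\vee,\textsc{match})\sqsubsetneq\mathrm{HML}^d(\min,\exists,\langle\,\rangle,\vee)$$ $$\sqsubsetneq\mathrm{HML}^d(\min,\exists,\langle\,\rangle,\vee,\wedge)\sqsubsetneq\mathrm{HML}^d(\min,\max,\exists,\forall,\langle\,\rangle,[\,],\vee,\wedge)=\mu\mathrm{HML}^d.$$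
   Context: **Data and traces.** Fix a countably infinite set $\mathbb{D}$ (data values) whose only predicate is equality. $\mathrm{Trc}=\mathbb{D}^\omega$. **Logic $\mu\mathrm{HML}^d$.** Let $\mathrm{DVar}$ and $\mathrm{FVar}$ be countably infinite sets of data variables $x$ and recursion variables $X$; $\star\notin\mathrm{DVar}$ is a placeholder for the current data value. Constraint expressions: $b::=\mathsf{true}\mid e=f\mid\neg b\mid b\wedge b$, with $e,f\in\mathrm{DVar}\cup\{\star\}$. Formulae: $\varphi::=\mathsf{tt}\mid\mathsf{ff}\mid\langle b\rangle\varphi\mid[b]\varphi\mid\exists x.\varphi\mid\forall x.\varphi\mid\varphi\vee\varphi\mid\varphi\wedge\varphi\mid\min X.\varphi\mid\max X.\varphi\mid X$. A data environment $\delta$ is a finite partial function $\mathrm{DVar}\rightharpoonup\mathbb{D}$; data interpretations $F$ map data environments to subsets of $\mathrm{Trc}$ (ordered pointwise by inclusion); trace environments $\rho$ map recursion variables to data interpretations. Semantics: $\mathsf{tt}\mapsto\mathrm{Trc}$; $\mathsf{ff}\mapsto\varnothing$; $[\![X,\rho,\delta]\!]=\rho(X)(\delta)$; $[\![\langle b\rangle\varphi,\rho,\delta]\!]=\{du\mid b\text{ true under }\delta[\star\mapsto d]\text{ and }u\in[\![\varphi,\rho,\delta]\!]\}$; $[\![[b]\varphi,\rho,\delta]\!]=\{du\mid b\text{ true under }\delta[\star\mapsto d]\text{ implies }u\in[\![\varphi,\rho,\delta]\!]\}$; $[\![\exists x.\varphi,\rho,\delta]\!]=\bigcup_{d}[\![\varphi,\rho,\delta[x\mapsto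 d]]\!]$; $[\![\forall x.\varphi,\rho,\delta]\!]=\bigcap_{d}[\![\varphi,\rho,\delta[x\mapsto d]]\!]$; $\vee,\wedge$ are union, intersection; $[\![\min X.\varphi,\rho,\delta]\!]$ (resp. $\max$) is the value at $\delta$ of the least (resp. greatest) fixed point of $F\mapsto\lambda\delta'.[\![\varphi,\rho[X\mapsto F],\delta']\!]$. For closed $\varphi$ write $[\![\varphi]\!]$. Standing assumption: each occurrence of a recursion variable is in the scope of a modality inside its defining fixed-point formula. **Fragments.** $\mathrm{HML}^d(\mathcal{C})$ is the set of closed formulae built from $\mathsf{tt}$ (and $\mathsf{ff}$ in the full logic) using only the constructs in $\mathcal{C}$ (recursion variables being available when a fixed-point operator is). Additional restrictions: $\textsc{match}$: every occurrence of $\exists$ is of the form $\exists x.\langle x=\star\wedge b\rangle\varphi$. $\textsc{det}$: the restriction $\textsc{match}$ holds and additionally all disjunctions are of the form $\bigvee_{i\in I}\exists x.\langle\star=x\wedge b_i\rangle\varphi_i$ with $I$ finite and $b_i\wedge b_j$ unsatisfiable for all $i\ne j$ in $I$. **Expressiveness.** For classes of formulae $\mathcal{L}_1,\mathcal{L}_2$: $\mathcal{L}_1\sqsubseteq\mathcal{L}_2$ if for each formula in $\mathcal{L}_1$ there is a formula in $\mathcal{L}_2$ with the same semantics; $\mathcal{L}_1\sqsubsetneq\mathcal{L}_2$ if $\mathcal{L}_1\sqsubseteq\mathcal{L}_2$ but not $\mathcal{L}_2\sqsubseteq\mathcal{L}_1$. *)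

(* Defs.v *)
From mathcomp Require Import all_boot.
From mathcomp Require Import finmap.
From mathcomp Require Import boolp classical_sets cardinality.

Set Implicit Arguments.
Unset Strict Implicit.
Unset Printing Implicit Defensive.

Local Open Scope classical_set_scope.

Definition dvar := nat.
Definition fvar := nat.

Inductive dexpr : Type :=
| Star
| DV of dvar.

Inductive constr : Type :=
| CTrue
| CEq of dexpr & dexpr
| CNot of constr
| CAnd of constr & constr.

Inductive form : Type :=
| Tt
| Ff
| Dia of constr & form
| Box of constr & form
| Ex of dvar & form
| All of dvar & form
| Or of form & form
| And of form & form
| Min of fvar & form
| Max of fvar & form
| Var of fvar.

Definition trace (D : Type) : Type := nat -> D.
Definition denv (D : Type) : Type := {fmap dvar -> D}.
Definition dinterp (D : Type) : Type := denv D -> set (trace D).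
Definition tenv (D : Type) : Type := fvar -> dinterp D.

Definition thead (D : Type) (t : trace D) : D := t 0.
Definition ttail (D : Type) (t : trace D) : trace D := fun n => t n.+1.

Definition dval (D : Type) (delta : denv D) (d : D) (e : dexpr) : option D :=
  match e with
  | Star => Some d
  | DV x => fnd delta x
  end.

(* [ceval delta d b]: b is true under delta[star |-> d].  An equation that
   mentions a variable outside dom(delta) counts as false; such environments
   never influence the value of a closed formula. *)
Fixpoint ceval (D : Type) (delta : denv D) (d : D) (b : constr) : Prop :=
  match b with
  | CTrue => True
  | CEq e f => exists v, dval delta d e = Some v /\ dval delta d f = Some v
  | CNot b1 => ~ ceval delta d b1
  | CAnd b1 b2 => ceval delta d b1 /\ ceval delta d b2
  end.

Definition dinterp_le (D : Type) (F G : dinterp D) : Prop :=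
  forall delta, F delta `<=` G delta.

Definition tupd (D : Type) (rho : tenv D) (X : fvar) (F : dinterp D) : tenv D :=
  fun Y => if Y == X then F else rho Y.

(* Knaster-Tarski; [sem_lfpP] and [sem_gfpP] below show that on the operators
   occurring in the semantics these are the least and greatest fixed points. *)
Definition lfp (D : Type) (Phi : dinterp D -> dinterp D) : dinterp D :=
  fun delta => \bigcap_(F in [set F | dinterp_le (Phi F) F]) F delta.

Definition gfp (D : Type) (Phi : dinterp D -> dinterp D) : dinterp D :=
  fun delta => \bigcup_(F in [set F | dinterp_le F (Phi F)]) F delta.

Fixpoint sem (D : Type) (phi : form) (rho : tenv D) (delta : denv D)
    : set (trace D) :=
  match phi with
  | Tt => setT
  | Ff => set0
  | Dia b psi =>
      [set t | ceval delta (thead t) b /\ sem psi rho delta (ttail t)]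
  | Box b psi =>
      [set t | ceval delta (thead t) b -> sem psi rho delta (ttail t)]
  | Ex x psi => \bigcup_(d : D) sem psi rho (setf delta x d)
  | All x psi => \bigcap_(d : D) sem psi rho (setf delta x d)
  | Or p q => sem p rho delta `|` sem q rho delta
  | And p q => sem p rho delta `&` sem q rho delta
  | Min X psi => lfp (fun F delta' => sem psi (tupd rho X F) delta') delta
  | Max X psi => gfp (fun F delta' => sem psi (tupd rho X F) delta') delta
  | Var X => rho X delta
  end.

(* For closed formulae the choice of environments is immaterial. *)
Definition csem (D : Type) (phi : form) : set (trace D) :=
  sem phi (fun _ _ => set0) fmap0.

Definition dexpr_fv (e : dexpr) : {fset dvar} :=
  (if e is DV x then [fset x] else fset0)%fset.

Fixpoint constr_fv (b : constr) : {fset dvar} :=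
  match b with
  | CTrue => fset0
  | CEq e f => (dexpr_fv e `|` dexpr_fv f)%fset
  | CNot b1 => constr_fv b1
  | CAnd b1 b2 => (constr_fv b1 `|` constr_fv b2)%fset
  end.

Fixpoint free_dvars (phi : form) : {fset dvar} :=
  match phi with
  | Tt | Ff | Var _ => fset0
  | Dia b psi | Box b psi => (constr_fv b `|` free_dvars psi)%fset
  | Ex x psi | All x psi => (free_dvars psi `\ x)%fset
  | Or p q | And p q => (free_dvars p `|` free_dvars q)%fset
  | Min _ psi | Max _ psi => free_dvars psi
  end.

Fixpoint free_fvars (phi : form) : {fset fvar} :=
  match phi with
  | Tt | Ff => fset0
  | Dia _ psi | Box _ psi | Ex _ psi | All _ psi => free_fvars psi
  | Or p q | And p q => (free_fvars p `|` free_fvars q)%fset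
  | Min X psi | Max X psi => (free_fvars psi `\ X)%fset
  | Var X => [fset X]%fset
  end.

Definition closed_form (phi : form) : Prop :=
  free_dvars phi = fset0 /\ free_fvars phi = fset0.

(* Recursion variables with a free occurrence that is not under a modality. *)
Fixpoint unguarded_fvars (phi : form) : {fset fvar} :=
  match phi with
  | Tt | Ff | Dia _ _ | Box _ _ => fset0
  | Ex _ psi | All _ psi => unguarded_fvars psi
  | Or p q | And p q => (unguarded_fvars p `|` unguarded_fvars q)%fset
  | Min X psi | Max X psi => (unguarded_fvars psi `\ X)%fset
  | Var X => [fset X]%fset
  end.

Fixpoint guarded (phi : form) : Prop :=
  match phi with
  | Tt | Ff | Var _ => True
  | Dia _ psi | Box _ psi | Ex _ psi | All _ psi => guarded psi
  | Or p q | And p q => guarded p /\ guarded q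
  | Min X psi | Max X psi => X \notin unguarded_fvars psi /\ guarded psi
  end.

Definition muHMLd : set form := [set phi | closed_form phi /\ guarded phi].

Inductive construct : Type :=
| cMin | cMax | cEx | cAll | cDia | cBox | cOr | cAnd.

(* ff is primitive only in the full logic, i.e. when C contains every
   construct; recursion variables come with any fixed-point operator. *)
Fixpoint built_from (C : set construct) (phi : form) : Prop :=
  match phi with
  | Tt => True
  | Ff => C = setT
  | Dia _ psi => C cDia /\ built_from C psi
  | Box _ psi => C cBox /\ built_from C psi
  | Ex _ psi => C cEx /\ built_from C psi
  | All _ psi => C cAll /\ built_from C psi
  | Or p q => [/\ C cOr, built_from C p & built_from C q]
  | And p q => [/\ C cAnd, built_from C p & built_from C q]
  | Min _ psi => C cMin /\ built_from C psi
  | Max _ psi => C cMax /\ built_from C psi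
  | Var _ => C cMin \/ C cMax
  end.

Definition HMLd (C : set construct) : set form := muHMLd `&` built_from C.

(* [match_guard x phi = Some b] iff phi is <x = star /\ b>psi for some psi; the
   equation may be written in either order. *)
Definition match_guard (x : dvar) (phi : form) : option constr :=
  match phi with
  | Dia (CAnd (CEq (DV y) Star) b) _
  | Dia (CAnd (CEq Star (DV y)) b) _ => if y == x then Some b else None
  | _ => None
  end.

Fixpoint match_restr (phi : form) : Prop :=
  match phi with
  | Tt | Ff | Var _ => True
  | Ex x psi => match_guard x psi /\ match_restr psi
  | Dia _ psi | Box _ psi | All _ psi | Min _ psi | Max _ psi =>
      match_restr psi
  | Or p q | And p q => match_restr p /\ match_restr q
  end.

(* Satisfiability ranges over the environments that define all variables of b. *)
Definition satisfiable (D : Type) (b : constr) : Prop :=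
  exists (delta : denv D) (d : D),
    (constr_fv b `<=` domf delta)%fset /\ ceval delta d b.

(* Finite disjunctions are iterated binary ones. *)
Fixpoint disjuncts (phi : form) : seq form :=
  if phi is Or p q then disjuncts p ++ disjuncts q else [:: phi].

(* [det_guard x phi = Some b] iff phi is (Ex x. <star = x /\ b>psi). *)
Definition det_guard (x : dvar) (phi : form) : option constr :=
  if phi is Ex y psi then if y == x then match_guard x psi else None else None.

Definition det_disj (D : Type) (phi : form) : Prop :=
  exists (x : dvar) (bs : seq constr),
    [seq det_guard x psi | psi <- disjuncts phi] = [seq Some b | b <- bs] /\
    forall i j, i < size bs -> j < size bs -> i <> j ->
      ~ satisfiable D (CAnd (nth CTrue bs i) (nth CTrue bs j)).

Fixpoint det_disjs (D : Type) (phi : form) : Prop :=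
  match phi with
  | Tt | Ff | Var _ => True
  | Dia _ psi | Box _ psi | Ex _ psi | All _ psi | Min _ psi | Max _ psi =>
      det_disjs D psi
  | Or p q => [/\ det_disj D (Or p q), det_disjs D p & det_disjs D q]
  | And p q => det_disjs D p /\ det_disjs D q
  end.

Definition det_restr (D : Type) : set form :=
  [set phi | match_restr phi /\ det_disjs D phi].

Definition expr_le (D : Type) (L1 L2 : set form) : Prop :=
  forall phi, L1 phi -> exists2 psi, L2 psi & csem psi = csem phi :> set (trace D).

Definition expr_lt (D : Type) (L1 L2 : set form) : Prop :=
  expr_le D L1 L2 /\ ~ expr_le D L2 L1.

Lemma sem_mono (D : Type) (phi : form) (rho rho' : tenv D) :
  (forall X, dinterp_le (rho X) (rho' X)) ->
  dinterp_le (sem phi rho) (sem phi rho').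
Proof.
elim: phi rho rho' => [||b p IH|b p IH|x p IH|x p IH|p IHp q IHq|p IHp q IHq
  |X p IH|X p IH|X] rho rho' le_rho delta t //=.
- by move=> [? ?]; split=> //; exact: (IH rho).
- by move=> h /h; exact: (IH rho).
- by move=> [d _ ?]; exists d => //; exact: (IH rho).
- by move=> h d _; apply: (IH rho) => //; exact: h.
- by case=> ?; [left; exact: (IHp rho)|right; exact: (IHq rho)].
- by case=> ? ?; split; [exact: (IHp rho)|exact: (IHq rho)].
- move=> h F /= leF; apply: h => /= d u hu; apply: leF; move: hu.
  by apply: IH => Y; rewrite /tupd; case: ifP => _; [move=> ? ?|exact: le_rho].
- move=> [F /= leF Ft]; exists F => //= d u /leF.
  by apply: IH => Y; rewrite /tupd; case: ifP => _; [move=> ? ?|exact: le_rho].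
- exact: le_rho.
Qed.

Lemma tupd_mono (D : Type) (phi : form) (rho : tenv D) X (F G : dinterp D) :
  dinterp_le F G ->
  dinterp_le (sem phi (tupd rho X F)) (sem phi (tupd rho X G)).
Proof. by move=> FG; apply: sem_mono => Y; rewrite /tupd; case: ifP => _ // ? ?. Qed.

Lemma sem_lfpP (D : Type) (phi : form) (rho : tenv D) (X : fvar) :
  let Phi := fun F => sem phi (tupd rho X F) in
  Phi (lfp Phi) = lfp Phi /\ forall F, Phi F = F -> dinterp_le (lfp Phi) F.
Proof.
move=> Phi.
have pre : dinterp_le (Phi (lfp Phi)) (lfp Phi).
  move=> delta t ht F /= leF; apply: (leF delta t); move: ht.
  by apply: tupd_mono => d u hu; exact: (hu F leF).
split; last by move=> F eF delta t ht; apply: (ht F) => /=; rewrite eF => ? ?.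
apply/funext => delta; apply/seteqP; split; first exact: pre.
by move=> t ht; apply: (ht (Phi (lfp Phi))) => /=; exact: tupd_mono.
Qed.

Lemma sem_gfpP (D : Type) (phi : form) (rho : tenv D) (X : fvar) :
  let Phi := fun F => sem phi (tupd rho X F) in
  Phi (gfp Phi) = gfp Phi /\ forall F, Phi F = F -> dinterp_le F (gfp Phi).
Proof.
move=> Phi.
have post : dinterp_le (gfp Phi) (Phi (gfp Phi)).
  move=> delta t [F /= leF /leF]; apply: tupd_mono => d u Fu.
  by exists F.
split; last by move=> F eF delta t Ft; exists F => //=; rewrite eF => ? ?.
apply/funext => delta; apply/seteqP; split; last exact: post.
by move=> t ht; exists (Phi (gfp Phi)) => //; apply: tupd_mono.
Qed.

(* Main.v *)
Require Import Defs.
From mathcomp Require Import all_boot.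
From mathcomp Require Import finmap.
From mathcomp Require Import boolp classical_sets cardinality.
From mathcomp Require Import zify.

Set Implicit Arguments.
Unset Strict Implicit.
Unset Printing Implicit Defensive.

Local Open Scope classical_set_scope.

(* The separating properties are "the first value recurs", "some value recurs",
   "two consecutive equal values that are new at that point", "the values up to
   the first recurrence of the initial value are distinct" and "the trace is
   constant".  Formulae without fixed points look at a bounded prefix only, and
   without greatest fixed points, boxes and universal quantifiers they denote
   open sets; this settles the first and the last inclusion.  If conjunction is
   excluded too, a formula behaves like an automaton whose registers are the data
   variables: after a prefix u, a run remembers at most as many values as there
   are variables, so exchanging in the rest v of the trace two values that are in
   no register preserves acceptance.  With enough distinct values in u v such an
   exchange leaves the property.  Under MATCH the registers hold only values
   already read; under DET there is only one run. *)

(** * Traces, exchanges of two values, and values outside all registers *)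

Section Traces.
Context {D : Type}.
Implicit Types (t v : trace D) (u : seq D) (delta : denv D) (pi : D -> D).

Definition tcons d t : trace D := fun n => if n is m.+1 then t m else d.

Definition tcat u t : trace D := foldr tcons t u.

Lemma tcat_mkseqE (f : nat -> D) n v i :
  tcat (mkseq f n) v i = if i < n then f i else v (i - n).
Proof.
suff gen m : tcat [seq f j | j <- iota m n] v i =
    if i < n then f (m + i) else v (i - n) by exact: gen.
elim: n m i => [|n IH] m i /=; first by rewrite subn0.
by case: i => [|i] /=; rewrite ?addn0 // IH addSnnS.
Qed.

Definition swap (a b c : D) : D :=
  if `[< c = a >] then b else if `[< c = b >] then a else c.

Lemma swapL a b : swap a b a = b.
Proof. by rewrite /swap; case: asboolP. Qed.

Lemma swapR a b : swap a b b = a.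
Proof. by rewrite /swap; case: asboolP => [->//|_]; case: asboolP. Qed.

Lemma swap_id a b c : c <> a -> c <> b -> swap a b c = c.
Proof. by rewrite /swap => ? ?; case: asboolP => // _; case: asboolP. Qed.

Lemma swapK a b : involutive (swap a b).
Proof.
move=> c; have [->|ca] := pselect (c = a); first by rewrite swapL swapR.
have [->|cb] := pselect (c = b); first by rewrite swapR swapL.
by rewrite !swap_id.
Qed.

Lemma swap_inj a b : injective (swap a b).
Proof. exact: inv_inj (@swapK a b). Qed.

Definition fixes pi delta := forall x d, fnd delta x = Some d -> pi d = d.

Definition denv_image pi delta delta' :=
  forall x, fnd delta' x = omap pi (fnd delta x).

Lemma fixes_image pi delta : fixes pi delta -> denv_image pi delta delta.
Proof. by move=> fix_pi x; case E: (fnd delta x) => [d|//] /=; rewrite (fix_pi _ _ E). Qed.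

Lemma fixes_swap a b delta :
  (forall x, fnd delta x <> Some a) -> (forall x, fnd delta x <> Some b) ->
  fixes (swap a b) delta.
Proof. by move=> Na Nb x d Ed; apply: swap_id => E; [apply: (Na x)|apply: (Nb x)]; rewrite -E. Qed.

Lemma denv_image_set pi delta delta' x d :
  denv_image pi delta delta' ->
  denv_image pi (setf delta x d) (setf delta' x (pi d)).
Proof. by move=> im y; rewrite !fnd_set; case: eqP => // _; exact: im. Qed.

(** Constraints only test equality, which an injective map preserves and reflects; undefined
    variables stay undefined. *)
Lemma ceval_image pi delta delta' d b : injective pi ->
  denv_image pi delta delta' -> ceval delta' (pi d) b <-> ceval delta d b.
Proof.
move=> pi_inj im.
have val e : dval delta' (pi d) e = omap pi (dval delta d e) by case: e => /=.
elim: b => [|e f|b IH|b IHb c IHc] //=; last 2 first.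
- by rewrite IH.
- by rewrite IHb IHc.
rewrite !val; split=> [[w []]|[w [-> ->]]]; last by exists (pi w).
case: (dval _ _ e) => [e1|//] /= [<-]; case: (dval _ _ f) => [f1|//] /= [/pi_inj ->].
by exists e1.
Qed.

(** Pigeonhole: if each of the [n] values were held, choosing a variable for each would inject [n]
    indices into [V]. *)
Lemma fresh_value (V : {fset dvar}) delta (e : nat -> D) m n :
  injective e -> (domf delta `<=` V)%fset -> (#|` V| < n)%N ->
  exists2 i, (m <= i < m + n)%N & forall x, fnd delta x <> Some (e i).
Proof.
move=> e_inj domV ltn; apply: contrapT => no.
have held i : exists x, (m <= i < m + n)%N -> fnd delta x = Some (e i).
  have [lti|] := boolP (m <= i < m + n)%N; last by exists 0.
  apply: contrapT => noi; apply: no; exists i => // x Ex.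
  by apply: noi; exists x.
have [f fP] := choice held.
suff : (size (map f (iota m n)) <= size (enum_fset V))%N.
  by rewrite size_map size_iota leqNgt ltn.
apply: uniq_leq_size.
  rewrite map_inj_in_uniq ?iota_uniq // => i j.
  rewrite !mem_iota => /fP Ei /fP Ej eq_f.
  by apply: e_inj; move: Ei; rewrite eq_f Ej => -[].
move=> x /mapP[i]; rewrite mem_iota => /fP Ei ->.
have : f i \in domf delta by rewrite -fndSome Ei.
by move/(fsubsetP domV).
Qed.

End Traces.

(** * Positive formulae *)

Fixpoint positive (conj : bool) (phi : form) : bool :=
  match phi with
  | Tt | Var _ => true
  | Dia _ psi | Ex _ psi | Min _ psi => positive conj psi
  | Or p q => positive conj p && positive conj q
  | And p q => [&& conj, positive conj p & positive conj q]
  | _ => false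
  end.

(** [conj] tells whether conjunction is allowed. [Ff] is never positive: it would require all
    constructs, hence also [cAll]. *)
Lemma built_from_positive (conj : bool) (C : set construct) phi :
  ~ C cAll -> ~ C cBox -> ~ C cMax -> (C cAnd -> conj) ->
  built_from C phi -> positive conj phi.
Proof.
move=> NAll NBox NMax Cconj; elim: phi => //=; last by move=> ? ? _ [].
- by move=> CT; case: NAll; rewrite CT.
- by move=> _ p IH [_ /IH].
- by move=> ? ? _ [].
- by move=> _ p IH [_ /IH].
- by move=> ? ? _ [].
- by move=> p IHp q IHq [_ /IHp -> /IHq ->].
- by move=> p IHp q IHq [/Cconj cc /IHp -> /IHq ->]; rewrite cc.
- by move=> _ p IH [_ /IH].
Qed.

Fixpoint bound_dvars (phi : form) : {fset dvar} :=
  match phi with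
  | Tt | Ff | Var _ => fset0
  | Dia _ psi | Box _ psi | Min _ psi | Max _ psi => bound_dvars psi
  | Ex x psi | All x psi => (x |` bound_dvars psi)%fset
  | Or p q | And p q => (bound_dvars p `|` bound_dvars q)%fset
  end.

(** * Invariance under injective renamings of data values *)

Section Invariance.
Context {D : Type}.
Implicit Types (t v : trace D) (u : seq D) (delta : denv D) (pi : D -> D).
Implicit Types (rho : tenv D).

Lemma sem_MinE psi rho X delta :
  sem (Min X psi) rho delta = sem psi (tupd rho X (sem (Min X psi) rho)) delta.
Proof. by have [/(congr1 (fun F => F delta)) /= E _] := sem_lfpP psi rho X. Qed.

Lemma lfp_ind psi rho X (G : dinterp D) :
  dinterp_le (sem psi (tupd rho X G)) G -> dinterp_le (sem (Min X psi) rho) G.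
Proof. by move=> leG delta t; apply. Qed.

(** The two trace environments serve the fixed-point case: there the recursion variable denotes a
    candidate prefixed point on the left and the fixed point itself on the right. *)
Lemma sem_image conj phi pi rho1 rho2 : injective pi -> positive conj phi ->
  (forall X delta delta' t, denv_image pi delta delta' ->
     rho1 X delta t -> rho2 X delta' (pi \o t)) ->
  forall delta delta' t, denv_image pi delta delta' ->
     sem phi rho1 delta t -> sem phi rho2 delta' (pi \o t).
Proof.
move=> pi_inj; elim: phi rho1 rho2 => //= [b p IH|x p IH|p IHp q IHq|p IHp q IHq
  |X p IH|X] rho1 rho2.
- move=> pos le_rho delta delta' t im [bt pt]; split.
    by apply/(ceval_image _ _ pi_inj im).
  exact: (IH _ _ pos le_rho _ _ _ im pt).
- move=> pos le_rho delta delta' t im [d _ pt]; exists (pi d) => //.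
  exact: (IH _ _ pos le_rho _ _ _ (denv_image_set _ _ im) pt).
- move=> /andP[posp posq] le_rho delta delta' t im [pt|qt].
    by left; apply: (IHp _ _ posp le_rho _ _ _ im pt).
  by right; apply: (IHq _ _ posq le_rho _ _ _ im qt).
- move=> /and3P[_ posp posq] le_rho delta delta' t im [pt qt]; split.
    exact: (IHp _ _ posp le_rho _ _ _ im pt).
  exact: (IHq _ _ posq le_rho _ _ _ im qt).
- move=> pos le_rho delta delta' t im pt; move: delta' im.
  pose G : dinterp D := fun delta => [set t | forall delta',
    denv_image pi delta delta' -> sem (Min X p) rho2 delta' (pi \o t)].
  suff /(_ delta t pt) : dinterp_le (sem (Min X p) rho1) G by apply.
  apply: lfp_ind => delta1 t1 pt1 delta' im; rewrite sem_MinE.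
  apply: (IH _ _ pos _ _ _ _ im pt1) => Y delta2 delta3 t2 im2.
  by rewrite /tupd; case: ifP => _; [apply|exact: le_rho].
- by move=> _ le_rho delta delta' t; exact: le_rho.
Qed.

Definition equivariant rho := forall pi X delta delta' t, injective pi ->
  denv_image pi delta delta' -> rho X delta t -> rho X delta' (pi \o t).

Lemma sem_equivariant conj phi pi rho delta delta' t :
  positive conj phi -> equivariant rho -> injective pi ->
  denv_image pi delta delta' ->
  sem phi rho delta t -> sem phi rho delta' (pi \o t).
Proof.
move=> pos eq_rho pi_inj; apply: (sem_image pi_inj pos).
by move=> X ? ? ?; exact: eq_rho.
Qed.

Lemma tupd_equivariant conj X psi rho : positive conj psi -> equivariant rho ->
  equivariant (tupd rho X (sem (Min X psi) rho)).
Proof.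
move=> pos eq_rho pi Y delta delta' t pi_inj im; rewrite /tupd.
by case: ifP => _; [exact: (@sem_equivariant conj (Min X psi))|exact: eq_rho].
Qed.

Lemma equivariant0 : equivariant (fun _ _ => set0).
Proof. by []. Qed.

(** MATCH leaves no choice of witness: the guard ties the quantified variable to the letter being
    read. *)
Lemma match_guard_sem x p rho delta d t : match_guard x p ->
  sem p rho (setf delta x d) t -> d = Defs.thead t.
Proof.
by case: p => // -[] // -[] // [|w] // [|w'] // b p /=; case: eqP => // -> _
  [[[s [/= + +]] _] _]; rewrite fnd_set eqxx => -[->] [].
Qed.

(** * Register contents of an accepting run after a finite prefix *)

Section Residual.
Variables (V : {fset dvar}) (matching : bool).

(* [delta'] plays the register contents of an accepting run on [u v] at the
   moment when [u] has been read. *)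
Definition residual delta u v (L : set (trace D)) := exists delta',
  [/\ (domf delta' `<=` V)%fset,
      matching -> forall x d, fnd delta' x = Some d ->
        (exists y, fnd delta y = Some d) \/ exists2 i, (i < size u)%N & nth d u i = d &
      forall pi, injective pi -> fixes pi delta' -> L (tcat u (pi \o v))].

(** A diamond reads a letter of the prefix, a quantifier writes a register, and once the prefix is
    used up the current environment is the required one, by equivariance. *)
Lemma sem_residual phi rho1 rho2 : positive false phi ->
  (bound_dvars phi `<=` V)%fset -> (matching -> match_restr phi) ->
  equivariant rho2 -> (forall X, dinterp_le (rho1 X) (rho2 X)) ->
  (forall X delta u v, (domf delta `<=` V)%fset ->
     rho1 X delta (tcat u v) -> residual delta u v (rho2 X delta)) ->
  forall delta u v, (domf delta `<=` V)%fset ->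
     sem phi rho1 delta (tcat u v) -> residual delta u v (sem phi rho2 delta).
Proof.
have base phi' rho delta v : positive false phi' -> equivariant rho ->
    (domf delta `<=` V)%fset -> sem phi' rho delta v ->
    residual delta [::] v (sem phi' rho delta).
  move=> pos eq_rho dV st; exists delta; split=> //.
    by move=> _ y d Ey; left; exists y.
  by move=> pi pi_inj /fixes_image im; apply: (sem_equivariant pos eq_rho pi_inj im).
elim: phi rho1 rho2 => // [|b p IH|x p IH|p IHp q IHq|X p IH|X] rho1 rho2 pos
  bV mat eq2 le12 res12 delta [|c u] v dV st.
1,2: by exists delta; split=> // _ y d Ey; left; exists y.
all: try (by apply: (base _ _ _ _ pos eq2 dV); exact: (sem_mono le12 st)).
- case: st => /= bc pt.
  have [delta' [dV' rng orb]] := IH _ _ pos bV mat eq2 le12 res12 delta u v dV pt.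
  exists delta'; split=> //.
    move=> m y d Ey; case: (rng m y d Ey) => [?|[i lti Ei]]; [by left|right].
    by exists i.+1.
  by move=> pi pi_inj fx; split=> //; exact: orb.
- case: st => d _ pt.
  have [xV pV] : x \in V /\ (bound_dvars p `<=` V)%fset.
    by move: bV => /=; rewrite fsubUset fsub1set => /andP.
  have dV1 : (domf (setf delta x d) `<=` V)%fset.
    by rewrite dom_setf fsubUset fsub1set xV dV.
  have mat' : matching -> match_restr p by move=> /mat /= [].
  have [delta' [dV' rng orb]] := IH _ _ pos pV mat' eq2 le12 res12 _ _ _ dV1 pt.
  exists delta'; split=> //; last by move=> pi pi_inj fx; exists d => //; exact: orb.
  move=> m y a Ey; case: (rng m y a Ey) => [[z]|]; last by right.
  rewrite fnd_set; case: eqP => [_ [<-]|_ Ez]; last by left; exists z.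
  (* The value just stored is the first letter of the prefix, by MATCH. *)
  by right; exists 0 => //=; have [mg _] := mat m; exact/esym/(match_guard_sem mg pt).
- move: pos mat bV => /= /andP[posp posq] mat; rewrite fsubUset => /andP[pV qV].
  case: st => [pt|qt].
    have matp : matching -> match_restr p by move=> /mat [].
    have [delta' [dV' rng orb]] := IHp _ _ posp pV matp eq2 le12 res12 _ _ _ dV pt.
    by exists delta'; split=> // pi pi_inj fx; left; exact: orb.
  have matq : matching -> match_restr q by move=> /mat [].
  have [delta' [dV' rng orb]] := IHq _ _ posq qV matq eq2 le12 res12 _ _ _ dV qt.
  by exists delta'; split=> // pi pi_inj fx; right; exact: orb.
(* The first component keeps the left environment below the right one; the second quantifies over
   all splittings because the variable is reached with a shorter prefix. *)
- pose G : dinterp D := fun delta => sem (Min X p) rho2 delta `&`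
    [set t | (domf delta `<=` V)%fset -> forall u v, t = tcat u v ->
       residual delta u v (sem (Min X p) rho2 delta)].
  suff /(_ delta _ st) : dinterp_le (sem (Min X p) rho1) G by case=> _ /(_ dV); exact.
  apply: lfp_ind => delta1 t pt.
  have le12' Y : dinterp_le (tupd rho1 X G Y) (tupd rho2 X (sem (Min X p) rho2) Y).
    by rewrite /tupd; case: ifP => _; [move=> ? ? []|exact: le12].
  split; first by rewrite sem_MinE; exact: (sem_mono le12' pt).
  move=> dV1 u1 v1 Et; rewrite sem_MinE; rewrite Et in pt.
  apply: (IH _ _ pos bV mat _ le12' _ _ _ _ dV1 pt).
    exact: (tupd_equivariant (psi := p) pos).
  move=> Y delta2 u2 v2 dV2; rewrite /tupd; case: ifP => _; last exact: res12.
  by case=> _ /(_ dV2); exact.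
- exact: res12.
Qed.

Lemma csem_residual phi u v : positive false phi ->
  (bound_dvars phi `<=` V)%fset -> (matching -> match_restr phi) ->
  csem phi (tcat u v) -> residual fmap0 u v (csem phi).
Proof.
move=> pos bV mat; apply: (sem_residual pos bV mat equivariant0) => //.
by move=> ? ? ?.
Qed.

End Residual.

(** * Deterministic disjunctions and the single run *)

Lemma disjuncts_sem phi rho delta t : sem phi rho delta t ->
  exists2 i, (i < size (disjuncts phi))%N & sem (nth Tt (disjuncts phi) i) rho delta t.
Proof.
elim: phi => //=; try by move=> *; exists 0.
move=> p IHp q IHq [/IHp|/IHq] [i lti it].
  by exists i; rewrite ?size_cat ?nth_cat ?lti //; lia.
exists (size (disjuncts p) + i); first by rewrite size_cat; lia.
by rewrite nth_cat ltnNge leq_addr /= addKn.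
Qed.

Lemma disjuncts_free phi i :
  (i < size (disjuncts phi))%N ->
  (free_dvars (nth Tt (disjuncts phi) i) `<=` free_dvars phi)%fset.
Proof.
elim: phi i => /=; try by move=> *; case: i => //.
all: try by move=> ? ? ? [].
all: try by move=> ? [].
all: try by move=> ? ? ? ? [].
all: try by case.
move=> p IHp q IHq i; rewrite size_cat nth_cat; case: ifP => [lti _|gei lti].
  exact: fsubset_trans (IHp _ lti) (fsubsetUl _ _).
by apply: fsubset_trans (IHq _ _) (fsubsetUr _ _); lia.
Qed.

Lemma det_guard_sem x psi b rho delta t : det_guard x psi = Some b ->
  sem psi rho delta t -> ceval (setf delta x (Defs.thead t)) (Defs.thead t) b.
Proof.
case: psi => //= y p; case: eqP => // -> .
by case: p => // -[] // -[] // [|w] // [|w'] // c p /=; case: eqP => // -> [<-] [d _]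
  [[[s [/= + +]] +] _]; rewrite fnd_set eqxx => -[<-] [E]; rewrite E.
Qed.

Lemma det_guard_free x psi b : det_guard x psi = Some b ->
  (constr_fv b `<=` x |` free_dvars psi)%fset.
Proof.
case: psi => //= y p; case: eqP => // -> .
by case: p => // -[] // -[] // [|w] // [|w'] // c p /=; case: eqP => // -> [<-];
  apply/fsubsetP => z zc; rewrite !inE zc ?orbT ?andbT /=; case: (z == x).
Qed.

(** The guards of the two successful disjuncts would both hold with [x] storing the common first
    letter [c], whatever follows it. The hypothesis on free variables makes this environment an
    admissible one for [satisfiable]. *)
Lemma det_disj_disjoint p q rho delta c v v' : det_disj D (Or p q) ->
  (free_dvars (Or p q) `<=` domf delta)%fset ->
  sem p rho delta (tcons c v) -> ~ sem q rho delta (tcons c v').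
Proof.
move=> [x [bs [gbs disj]]] fd /disjuncts_sem[i lti it] /disjuncts_sem[j ltj jt].
pose ds := disjuncts (Or p q).
have szE : size ds = size bs by have := congr1 size gbs; rewrite !size_map.
have guard k : (k < size ds)%N -> det_guard x (nth Tt ds k) = Some (nth CTrue bs k).
  move=> ltk; have := congr1 (fun s => nth None s k) gbs.
  by rewrite (nth_map Tt) // (nth_map CTrue) // -szE.
have szc : size ds = size (disjuncts p) + size (disjuncts q) by rewrite /ds /= size_cat.
set k := size (disjuncts p) + j.
have dsi : nth Tt ds i = nth Tt (disjuncts p) i by rewrite /ds /= nth_cat lti.
have dsk : nth Tt ds k = nth Tt (disjuncts q) j.
  by rewrite /ds /= nth_cat ltnNge leq_addr /= addKn.
have lti' : (i < size ds)%N by lia.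
have ltk : (k < size ds)%N by lia.
have fvb l : (l < size ds)%N -> (constr_fv (nth CTrue bs l) `<=` domf (setf delta x c))%fset.
  move=> ltl; apply: fsubset_trans (det_guard_free (guard l ltl)) _.
  rewrite dom_setf; apply: fsetUS; apply: fsubset_trans fd; exact: disjuncts_free.
apply: (disj i k); rewrite -?szE //; first by lia.
exists (setf delta x c), c; split; first by rewrite /= fsubUset !fvb.
split.
  by apply: (det_guard_sem (rho := rho) (t := tcons c v) (guard i lti')); rewrite dsi.
by apply: (det_guard_sem (rho := rho) (t := tcons c v') (guard k ltk)); rewrite dsk.
Qed.

Section Determinism.
Variable V : {fset dvar}.

(** One register content serves all continuations of [u], whereas [residual] lets it depend on the
    continuation. *)
Definition stable_quotient u (L : set (trace D)) := exists delta',
  (domf delta' `<=` V)%fset /\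
  forall pi, injective pi -> fixes pi delta' ->
    forall v, L (tcat u v) -> L (tcat u (pi \o v)).

(* [W] collects the data variables on which the interpretations of the free
   recursion variables rely: outside [W] guards of a deterministic disjunction
   need not be exclusive. *)
Lemma sem_stable_quotient phi (W : {fset dvar}) rho n : positive false phi ->
  (bound_dvars phi `<=` V)%fset -> match_restr phi -> det_disjs D phi ->
  guarded phi -> equivariant rho ->
  (forall X delta u, (W `<=` domf delta)%fset -> (domf delta `<=` V)%fset ->
     (size u < n + (X \in unguarded_fvars phi))%N ->
     stable_quotient u (rho X delta)) ->
  forall delta u, (W `|` free_dvars phi `<=` domf delta)%fset ->
     (domf delta `<=` V)%fset -> (size u <= n)%N ->
     stable_quotient u (sem phi rho delta).
Proof.
have base phi' rho' delta : positive false phi' -> equivariant rho' ->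
    (domf delta `<=` V)%fset -> stable_quotient [::] (sem phi' rho' delta).
  move=> pos eq_rho dV; exists delta; split=> // pi pi_inj /fixes_image im v.
  exact: (sem_equivariant pos eq_rho pi_inj im).
elim: phi W rho n => // [|b p IH|x p IH|p IHp q IHq|X p IH|X] W rho n pos
  bV mat det gd eq_rho sq delta [|c u] Wd dV lesz.
1,2: by exists delta.
all: try by apply: (base _ _ _ pos eq_rho dV).
(* If [c] violates the guard, no continuation is accepted and the claim is vacuous. *)
- have [bc|nb] := pselect (ceval delta c b); last by exists delta; split=> // pi _ _ v [/nb].
  have [||||delta' [dV' inv]] := IH W rho n.-1 pos bV mat det gd eq_rho _ delta u.
  (* Reading [c] lowers the length bound by one, which pays for the extra unit granted to variables
     unguarded in [p]. *)
  + move=> Y delta1 u1 W1 V1 lt1; apply: sq => //; apply: leq_trans (leq_addr _ _).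
    by move: lt1 lesz => /=; case: (Y \in _) => /=; lia.
  + by apply: fsubset_trans Wd; apply: fsetUS; exact: fsubsetUr.
  + by [].
  + by move: lesz => /=; lia.
  by exists delta'; split=> // pi pi_inj fx v [_ pt]; split=> //; exact: inv.
- case: mat => mg mat.
  have [xV pV] : x \in V /\ (bound_dvars p `<=` V)%fset.
    by move: bV => /=; rewrite fsubUset fsub1set => /andP.
  have [||delta' [dV' inv]] :=
    IH W rho n pos pV mat det gd eq_rho sq (setf delta x c) (c :: u) _ _ lesz.
  + move: Wd; rewrite dom_setf => /fsubsetP Wd; apply/fsubsetP => z zW.
    have := Wd z; move: zW; rewrite /= !inE.
    by case: (z == x) => //= -> ->.
  + by rewrite dom_setf fsubUset fsub1set xV dV.
  exists delta'; split=> // pi pi_inj fx v [d _ pt].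
  have Ed := match_guard_sem mg pt; rewrite /= /Defs.thead /= in Ed.
  by rewrite Ed in pt; exists c => //; exact: inv.
- move: pos mat det gd bV => /= /andP[posp posq] [matp matq] [dd detp detq] [gp gq].
  rewrite fsubUset => /andP[pV qV].
  have [Wp Wq] : (W `|` free_dvars p `<=` domf delta)%fset /\
                 (W `|` free_dvars q `<=` domf delta)%fset.
    by split; apply: fsubset_trans Wd; apply: fsetUS; [exact: fsubsetUl|exact: fsubsetUr].
  have fd : (free_dvars (Or p q) `<=` domf delta)%fset.
    by apply: fsubset_trans Wd; exact: fsubsetUr.
  (* If some continuation satisfies [p], none satisfies [q], so the registers of [p] serve the
     disjunction; otherwise those of [q] do. *)
  have [[v0 pv0]|nop] := pselect (exists v, sem p rho delta (tcat (c :: u) v)).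
    have [|delta' [dV' inv]] := IHp W rho n posp pV matp detp gp eq_rho _ _ _ Wp dV lesz.
      move=> Y delta1 u1 W1 V1 lt1; apply: sq => //; apply: leq_trans lt1 _.
      by rewrite /= inE leq_add2l; case: (Y \in unguarded_fvars p).
    exists delta'; split=> // pi pi_inj fx v [pt|qt]; first by left; exact: inv.
    by have := det_disj_disjoint dd fd pv0 qt.
  have [|delta' [dV' inv]] := IHq W rho n posq qV matq detq gq eq_rho _ _ _ Wq dV lesz.
    move=> Y delta1 u1 W1 V1 lt1; apply: sq => //; apply: leq_trans lt1 _.
    by rewrite /= inE leq_add2l; case: (Y \in unguarded_fvars q); rewrite ?orbT.
  exists delta'; split=> // pi pi_inj fx v [pt|qt]; last by right; exact: inv.
  by case: nop; exists v.
- case: gd => gX gd; rewrite /= in Wd.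
  (* Induction on the length of the prefix replaces fixed-point induction: [X] is guarded, so it is
     reached only after a letter has been read. *)
  suff main m : (m <= n)%N -> forall delta1 u1, (W `|` free_dvars p `<=` domf delta1)%fset ->
      (domf delta1 `<=` V)%fset -> (size u1 <= m)%N ->
      stable_quotient u1 (sem (Min X p) rho delta1).
    exact: (main n).
  elim/ltn_ind: m => m IHm lem delta1 u1 W1 V1 le1; rewrite sem_MinE.
  apply: (IH (W `|` free_dvars p)%fset _ m) => //.
  + exact: (tupd_equivariant (psi := p) pos).
  + move=> Y delta2 u2 W2 V2; rewrite /tupd; case: eqP => [->|/eqP neY] lt2.
      move: lt2; rewrite (negPf gX) addn0 => lt2.
      by apply: (IHm (size u2)) => //; lia.
    apply: sq => //; first by apply: fsubset_trans W2; exact: fsubsetUl.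
    by move: lt2; rewrite /= !inE neY /=; lia.
  + by rewrite -fsetUA fsetUid.
- apply: sq => //; first by apply: fsubset_trans Wd; exact: fsubsetUl.
  by rewrite /= inE eqxx addn1.
Qed.

End Determinism.

(** * Acceptance decided by finite prefixes *)

Lemma sem_open phi rho1 rho2 : positive true phi ->
  (forall X delta t, rho1 X delta t ->
     exists n, forall t', (forall i, (i < n)%N -> t' i = t i) -> rho2 X delta t') ->
  forall delta t, sem phi rho1 delta t ->
     exists n, forall t', (forall i, (i < n)%N -> t' i = t i) -> sem phi rho2 delta t'.
Proof.
elim: phi rho1 rho2 => //= [|b p IH|x p IH|p IHp q IHq|p IHp q IHq|X p IH|X] rho1 rho2.
- by exists 0.
- move=> pos op delta t [bt /(IH _ _ pos op)[n pn]]; exists n.+1 => t' Et.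
  split; first by rewrite /Defs.thead Et.
  by apply: pn => i lti; exact: Et.
- move=> pos op delta t [d _ /(IH _ _ pos op)[n pn]]; exists n => t' Et.
  by exists d => //; exact: pn.
- move=> /andP[posp posq] op delta t [/(IHp _ _ posp op)[n pn]|/(IHq _ _ posq op)[n pn]];
    exists n => t' Et; [left|right]; exact: pn.
- move=> /andP[posp posq] op delta t [/(IHp _ _ posp op)[n pn] /(IHq _ _ posq op)[m pm]].
  exists (maxn n m) => t' Et.
  by split; [apply: pn|apply: pm] => i lti; apply: Et; lia.
- move=> pos op delta t.
  (* The traces accepted on the strength of a finite prefix form a prefixed point. *)
  pose G : dinterp D := fun delta => [set t | exists n, forall t',
    (forall i, (i < n)%N -> t' i = t i) -> sem (Min X p) rho2 delta t'].
  have : dinterp_le (sem (Min X p) rho1) G; last exact.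
  apply: lfp_ind => delta1 t1; rewrite /G /mkset sem_MinE; apply: (IH _ _ pos) => Y.
  by rewrite /tupd; case: ifP => // _; exact: op.
- by move=> _; exact.
Qed.

(** Here [n] is the modal depth of the formula, hence uniform in the trace, unlike in [sem_open]. *)
Lemma sem_bounded phi : built_from [set cEx; cDia; cOr] phi ->
  exists n, forall rho delta t t', (forall i, (i < n)%N -> t' i = t i) ->
    sem phi rho delta t -> sem phi rho delta t'.
Proof.
elim: phi => //= [|CT|b p IH|b p _|x p IH|x p _|p IHp q IHq|p _ q _|X p _|X p _|X].
- by exists 0.
- by have : [set cEx; cDia; cOr] cMin; [rewrite CT|case=> [[]|]].
- move=> [_ /IH[n pn]]; exists n.+1 => rho delta t t' Et [bt pt].
  split; first by rewrite /Defs.thead Et.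
  by apply: pn pt => i lti; exact: Et.
- by case=> -[[]|].
- by move=> [_ /IH[n pn]]; exists n => rho delta t t' Et [d _ /(pn _ _ _ _ Et)]; exists d.
- by case=> -[[]|].
- move=> [_ /IHp[n pn] /IHq[m pm]]; exists (maxn n m) => rho delta t t' Et.
  by case=> [pt|qt]; [left; apply: pn pt|right; apply: pm qt] => i lti; apply: Et; lia.
- by case=> -[[]|].
- by case=> -[[]|].
- by case=> -[[]|].
- by case=> -[[]|].
Qed.

(** This is the until operator. The loop binds no data variable, so every unfolding takes place
    under the same [delta], and the invariant [G] speaks of that environment only. *)
Lemma sem_until rho delta X b psi t :
  (forall F, sem psi (tupd rho X F) delta = sem psi rho delta) ->
  sem (Min X (Or psi (Dia b (Var X)))) rho delta t <->
  exists n, sem psi rho delta (fun i => t (n + i)) /\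
    forall i, (i < n)%N -> ceval delta (t i) b.
Proof.
move=> psiX; split.
  pose G : dinterp D := fun delta' => [set t | delta' = delta -> exists n,
    sem psi rho delta (fun i => t (n + i)) /\ forall i, (i < n)%N -> ceval delta (t i) b].
  have : dinterp_le (sem (Min X (Or psi (Dia b (Var X)))) rho) G; last first.
    by move=> /(_ delta t) le /le; exact.
  apply: lfp_ind => delta1 t1 /= + eq_delta; rewrite eq_delta psiX.
  case=> [pt|[bt]]; first by exists 0.
  rewrite /tupd eqxx => /(_ erefl)[n [pt bn]]; exists n.+1; split=> //.
  by case=> // i; exact: bn.
case=> n; elim: n t => [|n IH] t [pt bn]; rewrite sem_MinE /= psiX; first by left.
right; split; first exact: bn.
by rewrite {1}/tupd eqxx; apply: IH; split=> // i; exact: (bn i.+1).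
Qed.

Lemma ceval_star_eq delta x d :
  ceval delta d (CEq (DV x) Star) <-> fnd delta x = Some d.
Proof. by move=> /=; split=> [[v [-> [->]]] //|->]; exists d. Qed.

End Invariance.

(** * The separating formulae *)

Notation star_eq x := (CEq (DV x) Star).

(** Variable 0 keeps the first value; variable 1 is rebound at every letter to give the disjuncts
    the shape that DET prescribes, with complementary guards. *)
Definition first_recurs := Ex 0 (Dia (CAnd (star_eq 0) CTrue) (Min 0 (Or
  (Ex 1 (Dia (CAnd (star_eq 1) (star_eq 0)) Tt))
  (Ex 1 (Dia (CAnd (star_eq 1) (CNot (star_eq 0))) (Var 0)))))).

(** The outer loop guesses the position whose value is stored; the inner loop waits for that
    value. *)
Definition some_recurs := Min 0 (Or
  (Ex 0 (Dia (CAnd (star_eq 0) CTrue)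
    (Min 1 (Or (Dia (star_eq 0) Tt) (Dia CTrue (Var 1))))))
  (Dia CTrue (Var 0))).

(** The value is guessed before any letter is read, so that the loop can check its absence until it
    appears twice in a row. *)
Definition fresh_doubled := Ex 0 (Min 0 (Or
  (Dia (star_eq 0) (Dia (star_eq 0) Tt))
  (Dia (CNot (star_eq 0)) (Var 0)))).

(** At each letter the conjunction starts a side run, which checks that this letter does not return
    before the initial value does. *)
Definition distinct_until_first := Ex 0 (Dia (star_eq 0) (Min 0 (Or
  (Dia (star_eq 0) Tt)
  (Ex 1 (Dia (star_eq 1) (And (Var 0)
    (Min 1 (Or (Dia (star_eq 0) Tt) (Dia (CNot (star_eq 1)) (Var 1)))))))))).

Definition constant_trace := Ex 0 (Max 0 (Dia (star_eq 0) (Var 0))).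

(* Innermost conditions first: [lia] does not see through a conditional that
   occurs inside a condition. *)
Ltac split_ifs := repeat match goal with
  |- context [if ?c then _ else _] =>
    lazymatch c with
    | context [if _ then _ else _] => fail
    | _ => let H := fresh in case: (boolP c) => H /=
    end
  end.

(** * Meaning of the separating formulae *)

Section Witnesses.
Variable D : Type.
Implicit Types (t : trace D) (delta : denv D).

Lemma closed_guarded :
  [/\ muHMLd first_recurs, muHMLd some_recurs, muHMLd fresh_doubled,
      muHMLd distinct_until_first & muHMLd constant_trace].
Proof.
split; (split; [split; apply/fsetP => -[|[|z]] /=; rewrite !inE //|
  by rewrite /= ?inE]).
Qed.

Lemma first_recurs_det : det_restr D first_recurs.
Proof.
split=> //=; split=> //; exists 1, [:: star_eq 0; CNot (star_eq 0)].
split=> // -[|[|i]] [|[|j]] //= _ _ _ [delta [d [_ [p q]]]].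
  exact: q.
exact: p.
Qed.

Lemma csem_first_recurs t : csem first_recurs t <-> exists n, t n.+1 = t 0.
Proof.
pose body := Or (Ex 1 (Dia (CAnd (star_eq 1) (star_eq 0)) Tt))
  (Ex 1 (Dia (CAnd (star_eq 1) (CNot (star_eq 0))) (Var 0))).
(* The loop rebinds variable 1, so [sem_until] does not apply; the claim is stated for every
   environment that stores [a] in variable 0. *)
have rec (rho : tenv D) delta a t1 : fnd delta 0 = Some a ->
    sem (Min 0 body) rho delta t1 <-> exists n, t1 n = a.
  move=> Ea; split.
    pose G : dinterp D := fun delta => [set t | fnd delta 0 = Some a -> exists n, t n = a].
    have : dinterp_le (sem (Min 0 body) rho) G; last by move=> /(_ delta t1) le /le; exact.
    apply: lfp_ind => delta2 t2 p E2.
    have E3 d : fnd (setf delta2 1 d) 0 = Some a by rewrite fnd_set.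
    case: p => [[d _ [[_ /ceval_star_eq]]]|[d _ [_ Gt]]].
      by rewrite E3 => -[Et] _; exists 0.
    by have [n En] := Gt (E3 d); exists n.+1.
  case=> n; elim: n delta t1 Ea => [|n IH] delta t1 Ea En; rewrite sem_MinE.
    left; exists (t1 0) => //; split=> //.
    by split; apply/ceval_star_eq; rewrite fnd_set //= Ea -En.
  have [E0|N0] := pselect (t1 0 = a).
    left; exists (t1 0) => //; split=> //.
    by split; apply/ceval_star_eq; rewrite fnd_set //= Ea -E0.
  right; exists (t1 0) => //; split; last by apply: (IH _ (ttail t1)); rewrite ?fnd_set.
  split; first by apply/ceval_star_eq; rewrite fnd_set.
  by move=> /ceval_star_eq; rewrite fnd_set /= Ea => -[/esym].
split.
  move=> [d _ [[/ceval_star_eq + _] /(rec _ _ d)[|n En]]]; rewrite fnd_set //.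
  by case=> Ed; exists n; rewrite -[LHS]/(ttail t n) En.
case=> n En; exists (t 0) => //; split.
  by split=> //; apply/ceval_star_eq; rewrite fnd_set.
by apply/(rec _ _ (t 0)); [rewrite fnd_set|exists n].
Qed.

Lemma csem_some_recurs t : csem some_recurs t <-> exists i j, i < j /\ t i = t j.
Proof.
pose later := Min 1 (Or (Dia (star_eq 0) Tt) (Dia CTrue (Var 1))).
have laterP (rho : tenv D) delta d t1 : fnd delta 0 = Some d ->
    sem later rho delta t1 <-> exists n, t1 n = d.
  move=> Ed; rewrite sem_until //; split=> [[n [[/ceval_star_eq + _] _]]|[n En]].
    by rewrite /Defs.thead addn0 Ed => -[->]; exists n.
  exists n; split=> //; split=> //.
  by apply/ceval_star_eq; rewrite /Defs.thead addn0 Ed En.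
rewrite /csem sem_until //; split.
  case=> n [[d _ [[/ceval_star_eq + _] /(laterP _ _ d) lt]] _]; rewrite fnd_set => -[Ed].
  have [|m Em] := lt; first by rewrite fnd_set.
  exists n, (n + m.+1); split; first lia.
  by move: Em Ed; rewrite /ttail /Defs.thead addn0 => -> ->.
case=> i [j [ltij Eij]]; exists i; split=> //; exists (t i) => //; split.
  by split=> //; apply/ceval_star_eq; rewrite fnd_set // /Defs.thead addn0.
apply/(laterP _ _ (t i)); first by rewrite fnd_set.
by exists (j - i.+1); rewrite Eij /ttail; congr t; lia.
Qed.

Lemma csem_fresh_doubled t : csem fresh_doubled t <->
  exists n, t n = t n.+1 /\ forall i, i < n -> t i <> t n.
Proof.
pose loop := Min 0 (Or (Dia (star_eq 0) (Dia (star_eq 0) Tt))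
  (Dia (CNot (star_eq 0)) (Var 0))).
have loopP (rho : tenv D) delta d : fnd delta 0 = Some d ->
    sem loop rho delta t <->
    exists n, [/\ t n = d, t n.+1 = d & forall i, i < n -> t i <> d].
  move=> Ed; rewrite sem_until //; split=> [[n [pt bn]]|[n [En En1 Nn]]]; exists n.
    case: pt => /ceval_star_eq + [/ceval_star_eq + _].
    rewrite /ttail /Defs.thead addn0 addn1 Ed => -[Et] [Et1]; split=> // i /bn nb Ei.
    by apply: nb; apply/ceval_star_eq; rewrite Ed Ei.
  split; last by move=> i /Nn nE /ceval_star_eq; rewrite Ed => -[/esym].
  split; first by apply/ceval_star_eq; rewrite Ed /Defs.thead addn0 En.
  by split=> //; apply/ceval_star_eq; rewrite Ed /Defs.thead /ttail addn1 En1.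
split=> [[d _ /(loopP _ _ d) lt]|[n [En Nn]]].
  have [|n [En En1 Nn]] := lt; first by rewrite fnd_set.
  by exists n; rewrite En En1.
exists (t n) => //; apply/(loopP _ _ (t n)); first by rewrite fnd_set.
by exists n; split=> //; rewrite -En.
Qed.

Lemma csem_distinct_until_first t : csem distinct_until_first t <->
  exists n, [/\ t n.+1 = t 0, forall i, i < n -> t i.+1 <> t 0 &
    forall i j, i < j -> j < n -> t i.+1 <> t j.+1].
Proof.
pose wait := Min 1 (Or (Dia (star_eq 0) Tt) (Dia (CNot (star_eq 1)) (Var 1))).
pose body := Or (Dia (star_eq 0) Tt) (Ex 1 (Dia (star_eq 1) (And (Var 0) wait))).
pose good a (t : trace D) := exists n, [/\ t n = a, forall i, i < n -> t i <> a &
    forall i j, i < j -> j < n -> t i <> t j].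
have waitP (rho : tenv D) delta a c t1 : fnd delta 0 = Some a -> fnd delta 1 = Some c ->
    sem wait rho delta t1 <-> exists n, t1 n = a /\ forall i, i < n -> t1 i <> c.
  move=> Ea Ec; rewrite sem_until //; split=> -[n [p q]]; exists n; split.
  - by case: p => /ceval_star_eq; rewrite /Defs.thead addn0 Ea => -[->].
  - by move=> i /q /= nE Ei; apply: nE; apply/ceval_star_eq; rewrite Ec Ei.
  - by split=> //; apply/ceval_star_eq; rewrite /Defs.thead addn0 Ea p.
  - by move=> i /q nE /ceval_star_eq; rewrite Ec => -[/esym].
have rec (rho : tenv D) delta a t1 : fnd delta 0 = Some a ->
    sem (Min 0 body) rho delta t1 <-> good a t1.
  move=> Ea; split.
    pose G : dinterp D := fun delta => [set t | fnd delta 0 = Some a -> good a t].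
    have : dinterp_le (sem (Min 0 body) rho) G; last by move=> /(_ delta t1) le /le; exact.
    apply: lfp_ind => delta2 t2 p E2.
    have [E0|N0] := pselect (t2 0 = a); first by exists 0.
    case: p => [[/ceval_star_eq]|[d _ [/ceval_star_eq + [Gt /waitP wt]]]].
      by rewrite E2 => -[/esym].
    rewrite fnd_set => -[Ed].
    have [|n [En Na Nn]] := Gt; first by rewrite fnd_set.
    have [||m [Em Nm]] := wt a d; rewrite ?fnd_set //.
    (* In the tail, [a] first occurs at [n], so the side run, which stops at an occurrence [m] of
       [a], covers all positions below [n]. *)
    have lenm : n <= m by rewrite leqNgt; apply/negP => /Na.
    exists n.+1; split=> // [[|i] //|[|i] [|j] //]; [exact: Na| |exact: (Nn i j)].
    by move=> _ ltj E; apply: (Nm j); [lia|rewrite Ed [RHS]E].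
  case=> n; elim: n delta t1 Ea => [|n IH] delta t1 Ea [En Na Nn]; rewrite sem_MinE.
    by left; split=> //; apply/ceval_star_eq; rewrite Ea -En.
  right; exists (t1 0) => //; split; first by apply/ceval_star_eq; rewrite fnd_set.
  split.
    apply: (IH _ (ttail t1)); first by rewrite fnd_set.
    split=> // [i lti|i j ltij ltj]; [exact: (Na i.+1)|exact: (Nn i.+1 j.+1)].
  apply/(waitP _ _ a (t1 0)); rewrite ?fnd_set //; exists n; split=> // i lti.
  exact/nesym/(Nn 0 i.+1).
split.
  move=> [d _ [/ceval_star_eq + /(rec _ _ d) gd]]; rewrite fnd_set => -[Ed].
  by rewrite -[t 0]Ed; apply: gd; rewrite fnd_set.
move=> gd; exists (t 0) => //; split; last by apply/(rec _ _ (t 0)); first by rewrite fnd_set.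
by apply/ceval_star_eq; rewrite fnd_set.
Qed.

Lemma csem_constant_trace t : csem constant_trace t <-> exists d, t = fun=> d.
Proof.
split=> [[d _ /= [F leF Ft]]|[d ->]].
  exists d; apply/funext => n; move: leF => /=.
  pose delta : denv D := setf fmap0 0 d; rewrite -/delta in Ft => leF.
  elim: n t Ft => [|n IH] t /leF[/ceval_star_eq + Ft].
    by rewrite fnd_set => -[].
  by move=> _; exact: (IH (ttail t)).
exists d => //; exists (fun delta => [set t | fnd delta 0 = Some d /\ t = fun=> d]).
  move=> delta _ [E ->] /=; split; last by rewrite /tupd eqxx.
  exact/ceval_star_eq.
by rewrite /= fnd_set.
Qed.


(** * Separation by exchanging values after a prefix *)

Lemma swap_suffix (e : nat -> D) (f : nat -> nat) n i j : injective e ->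
  tcat (mkseq (e \o f) n) (swap (e i) (e j) \o (fun k => e (f (n + k)))) =
  fun k => e (if k < n then f k else if f k == i then j else if f k == j then i else f k).
Proof.
move=> e_inj; apply/funext => k; rewrite tcat_mkseqE; case: ltnP => //= lenk.
rewrite subnKC //; case: eqP => [->|ni]; first by rewrite swapL.
case: eqP => [->|nj]; first by rewrite swapR.
by rewrite swap_id // => /e_inj.
Qed.

(** Writing a trace as [e] after an index map [f] turns equality of values into arithmetic, as [e]
    is injective. *)
Lemma split_trace (e : nat -> D) (f : nat -> nat) n :
  (fun k => e (f k)) = tcat (mkseq (e \o f) n) (fun k => e (f (n + k))).
Proof.
by apply/funext => k; rewrite tcat_mkseqE; case: ltnP => //= lenk; rewrite subnKC.
Qed.

Lemma infinite_injection : infinite_set [set: D] -> exists e : nat -> D, injective e.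
Proof.
elim/Ppointed: D => [T|T /infiniteP/pcard_injP[f f_inj]].
  by rewrite emptyE => -[].
by exists f => x y Exy; apply: f_inj; rewrite ?in_setT.
Qed.

Context (e : nat -> D) (e_inj : injective e).

Lemma first_recurs_unbounded phi : built_from [set cEx; cDia; cOr] phi ->
  csem phi <> csem first_recurs :> set (trace D).
Proof.
move=> /(@sem_bounded D)[n bnd] E.
suff : csem phi e.
  by rewrite E => /csem_first_recurs[k /e_inj].
(* The first value recurs only from position [n.+1] on, beyond the [n] letters that [phi]
   inspects. *)
apply: (bnd _ _ (fun k => e (if k < n.+1 then k else 0))).
  by move=> i lti; rewrite ltnS ltnW.
rewrite -/(csem phi) E; apply/csem_first_recurs; exists n.
by rewrite ltnn.
Qed.

Lemma some_recurs_nondeterministic phi : muHMLd phi -> positive false phi ->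
  det_restr D phi -> csem phi <> csem some_recurs :> set (trace D).
Proof.
move=> [[fd _] gd] pos [mat det] E; pose V := bound_dvars phi; pose N := #|` V|.+1.
pose u := mkseq e N.
have [delta [dV inv]] : stable_quotient V u (csem phi).
  apply: (sem_stable_quotient (W := fset0) (n := N) pos (fsubset_refl _) mat det gd
    equivariant0).
  - by move=> *; exists fmap0; split=> //; exact: fsub0set.
  - by rewrite fd fsetU0.
  - exact: fsub0set.
  - by rewrite size_mkseq.
have [i lti freshi] := fresh_value 0 e_inj dV (ltnSn _).
have [j ltj freshj] := fresh_value N e_inj dV (ltnSn _).
(* The continuation may depend on [delta], by determinism. It repeats [e i] and then uses indices
   above [2N], so [e j] occurs nowhere and the exchange removes the only repetition. *)
pose f k := if k < N then k else if k == N then i else k + N.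
have uE : u = mkseq (e \o f) N.
  by apply/eq_in_map => k; rewrite mem_iota /= /f => ->.
have : csem phi (fun k => e (f k)).
  rewrite E; apply/csem_some_recurs; exists i, N; split; first by lia.
  by congr e; rewrite /f ltnn eqxx; case: ifP; lia.
rewrite (split_trace e f N) -uE.
move/(inv _ (@swap_inj _ (e i) (e j)) (fixes_swap freshi freshj)).
rewrite uE swap_suffix // E => /csem_some_recurs[a [b [ltab /e_inj]]].
by rewrite /f; split_ifs; lia.
Qed.

Lemma fresh_doubled_not_matching phi : positive false phi -> match_restr phi ->
  csem phi <> csem fresh_doubled :> set (trace D).
Proof.
move=> pos mat E; pose V := bound_dvars phi; pose N := #|` V|.+1.
(* All values are distinct except that [e N.+1], the first one after the prefix of [N.+1] letters,
   is doubled. *)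
pose f k := if k < N.+2 then k else k.-1.
have : csem phi (fun k => e (f k)).
  rewrite E; apply/csem_fresh_doubled; exists N.+1; split.
    by congr e; rewrite /f; split_ifs; lia.
  by move=> k ltk /e_inj; rewrite /f; split_ifs; lia.
rewrite (split_trace e f N.+1).
case/(csem_residual (V := V) (matching := true) pos (fsubset_refl _) (fun=> mat)).
move=> delta [dV read orb].
have [i lti freshi] := fresh_value 0 e_inj dV (ltnSn _).
(* This value has not been read yet, so MATCH keeps it out of the registers. The exchange then
   doubles [e i], which already occurs in the prefix. *)
have freshj x : fnd delta x <> Some (e N.+1).
  case/(read isT) => [[y]|[k]]; first by rewrite fnd_fmap0.
  by rewrite size_mkseq => ltk; rewrite nth_mkseq //= => /e_inj; rewrite /f; case: ifP; lia.
have := orb _ (@swap_inj _ (e i) (e N.+1)) (fixes_swap freshi freshj).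
rewrite swap_suffix // E => /csem_fresh_doubled[n [/e_inj En Nn]].
have En' : n = N.+1 by move: En; rewrite /f; split_ifs; lia.
by apply: (Nn i); [lia|congr e; rewrite En' /f; split_ifs; lia].
Qed.

Lemma distinct_until_first_alternating phi : positive false phi ->
  csem phi <> csem distinct_until_first :> set (trace D).
Proof.
move=> pos E; pose V := bound_dvars phi; pose N := #|` V|.+1.
pose f k := if k < N.*2.+1 then k else 0.
have : csem phi (fun k => e (f k)).
  rewrite E; apply/csem_distinct_until_first; exists N.*2; split.
  - by congr e; rewrite /f; split_ifs; lia.
  - by move=> k ltk /e_inj; rewrite /f; split_ifs; lia.
  - by move=> k l ltk ltl /e_inj; rewrite /f; split_ifs; lia.
rewrite (split_trace e f N.+1).
have mat : false -> match_restr phi by [].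
case/(csem_residual (V := V) (matching := false) pos (fsubset_refl _) mat).
move=> delta [dV _ orb].
(* Index [i] lies in the prefix and [j] after it; index 0 is avoided so that the initial value
   recurs where it did. The exchange puts a second [e i] before that recurrence. *)
have [i lti freshi] := fresh_value 1 e_inj dV (ltnSn _).
have [j ltj freshj] := fresh_value N.+1 e_inj dV (ltnSn _).
have := orb _ (@swap_inj _ (e i) (e j)) (fixes_swap freshi freshj).
rewrite swap_suffix // E => /csem_distinct_until_first[n [/e_inj En _ Nn]].
have len : N.*2 <= n by move: En; rewrite /f; split_ifs; lia.
apply: (Nn i.-1 j.-1); [lia|lia|congr e].
by rewrite /f; split_ifs; lia.
Qed.

Lemma constant_trace_not_open phi : positive true phi ->
  csem phi <> csem constant_trace :> set (trace D).
Proof.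
move=> pos E.
have : csem phi (fun=> e 0) by rewrite E; apply/csem_constant_trace; exists (e 0).
case/(sem_open (rho2 := fun _ _ => set0) pos) => // n.
(* The boolean is read as a number: the trace has [e 0] up to position [n] and [e 1] afterwards. *)
move=> /(_ (fun k => e (n < k))) op; have : csem phi (fun k => e (n < k)).
  by apply: op => i lti; rewrite ltnNge ltnW.
rewrite E => /csem_constant_trace[d Ed].
have /e_inj : e (n < 0) = e (n < n.+1).
  by rewrite [LHS](congr1 (@^~ 0) Ed) [RHS](congr1 (@^~ n.+1) Ed).
by rewrite ltnSn.
Qed.

End Witnesses.

(** * Monotonicity in the constructs and the chain of inclusions *)

Lemma built_from_mono (C C' : set construct) phi : C `<=` C' ->
  built_from C phi -> built_from C' phi.
Proof.
move=> CC'; elim: phi => //=.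
(* For [Ff], the smaller set is already full, hence so is the larger one. *)
- by move=> CT; apply/seteqP; split=> // c _; apply: CC'; rewrite CT.
- by move=> _ p IH [/CC' ? /IH].
- by move=> _ p IH [/CC' ? /IH].
- by move=> _ p IH [/CC' ? /IH].
- by move=> _ p IH [/CC' ? /IH].
- by move=> p IHp q IHq [/CC' ? /IHp ? /IHq].
- by move=> p IHp q IHq [/CC' ? /IHp ? /IHq].
- by move=> _ p IH [/CC' ? /IH].
- by move=> _ p IH [/CC' ? /IH].
- by move=> _ [/CC'|/CC']; [left|right].
Qed.

Lemma all_constructs : [set cMin; cMax; cEx; cAll; cDia; cBox; cOr; cAnd] = setT.
Proof. by apply/seteqP; split=> // -[] _; rewrite /setU /mkset /=; tauto. Qed.

Theorem theorem60 (D : Type)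
    (hD : countable [set: D]) (hDinf : infinite_set [set: D]) :
  [/\ expr_lt D
        (HMLd [set cEx; cDia; cOr] `&` det_restr D)
        (HMLd [set cMin; cEx; cDia; cOr] `&` det_restr D),
      expr_lt D
        (HMLd [set cMin; cEx; cDia; cOr] `&` det_restr D)
        (HMLd [set cMin; cEx; cDia; cOr] `&` match_restr),
      expr_lt D
        (HMLd [set cMin; cEx; cDia; cOr] `&` match_restr)
        (HMLd [set cMin; cEx; cDia; cOr]),
      expr_lt D
        (HMLd [set cMin; cEx; cDia; cOr])
        (HMLd [set cMin; cEx; cDia; cOr; cAnd]) &
      expr_lt D
        (HMLd [set cMin; cEx; cDia; cOr; cAnd])
        (HMLd [set cMin; cMax; cEx; cAll; cDia; cBox; cOr; cAnd]) /\
      HMLd [set cMin; cMax; cEx; cAll; cDia; cBox; cOr; cAnd] = muHMLd].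
Proof.
have [e e_inj] := infinite_injection hDinf.
have [mu1 mu2 mu3 mu4 mu5] := closed_guarded.
have pos phi : HMLd [set cMin; cEx; cDia; cOr] phi -> positive false phi.
  by case=> _; apply: built_from_positive => // C; do ?case: C => C.
have pos_and phi : HMLd [set cMin; cEx; cDia; cOr; cAnd] phi -> positive true phi.
  by case=> _; apply: built_from_positive => // C; do ?case: C => C.
have incl (C C' : set construct) : C `<=` C' -> HMLd C `<=` HMLd C'.
  by move=> CC' phi [mu /(built_from_mono CC')].
have le (L L' : set form) : L `<=` L' -> expr_le D L L'.
  by move=> LL' phi /LL' L'phi; exists phi.
split.
- split; first by apply: le; apply: setSI; apply: incl; rewrite /setU /mkset => c /=; tauto.
  case/(_ first_recurs) => [|phi [[_ built] _]].
    split; last exact: first_recurs_det.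
    by split=> //; rewrite /= /setU /mkset /=; do ?split; tauto.
  exact: (first_recurs_unbounded e_inj built).
- split; first by apply: le => phi [? []].
  case/(_ some_recurs) => [|phi [/[dup] [[mu _]] /pos posphi det]].
    split=> //.
    by split=> //; rewrite /= /setU /mkset /=; do ?split; tauto.
  exact: (some_recurs_nondeterministic e_inj).
- split; first by apply: le => phi [].
  case/(_ fresh_doubled) => [|phi [/pos posphi mat]].
    by split=> //; rewrite /= /setU /mkset /=; do ?split; tauto.
  exact: (fresh_doubled_not_matching e_inj).
- split; first by apply: le; apply: incl; rewrite /setU /mkset => c /=; tauto.
  case/(_ distinct_until_first) => [|phi /pos posphi].
    by split=> //; rewrite /= /setU /mkset /=; do ?split; tauto.
  exact: (distinct_until_first_alternating e_inj).
have full : HMLd setT = muHMLd.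
  apply/seteqP; split=> [phi []//|phi mu]; split=> // {mu}.
  by elim: phi => //= *; left.
rewrite all_constructs; split=> //; split; first by apply: le; apply: incl.
case/(_ constant_trace) => [|phi /pos_and posphi]; first by rewrite full.
exact: (constant_trace_not_open e_inj).
Qed.
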